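(* Let $f(x)\in\mathbb{Z}[x]$ be a polynomial that is not of the form $a\,g(x)^d$ with $a\in\mathbb{Z}$, $g\in\mathbb{Z}[x]$ and $d>1$ an integer. For a prime $p$, let $g_{p,f}$ be the number of elements $y\in\mathbb{F}_p$ such that $f(y)\bmod p$ is a primitive root modulo $p$. Then, as $p\to+\infty$ over the primes, $$g_{p,f}=\frac{p\cdot\varphi(p-1)}{p-1}\,(1+o(1)).$$
   Context: An element of $\mathbb{F}_p$ is a primitive root modulo $p$ if it generates the cyclic group $\mathbb{F}_p^*$. $\varphi$ is the Euler totient function. *)

(* Defs.v *)
From mathcomp Require Import all_boot all_order all_algebra all_fingroup.
From mathcomp Require Import all_solvable.
Set Implicit Arguments.
Unset Strict Implicit.
Unset Printing Implicit Defensive.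
Import GRing.Theory.
Local Open Scope ring_scope.

(* 'F_p is the field with p elements only when p is prime; the definitions
   below are meaningful for such p. *)
Definition primitive_root_mod (p : nat) (x : 'F_p) : bool :=
  [exists u : {unit 'F_p}, (val u == x) && generator [set: {unit 'F_p}] u].

Definition num_primitive_values (f : {poly int}) (p : nat) : nat :=
  #|[set y : 'F_p | primitive_root_mod (map_poly intr f).[y]]|.

Definition const_times_power (f : {poly int}) : Prop :=
  exists (a : int) (g : {poly int}) (d : nat), (1 < d)%N /\ f = a *: g ^+ d.

(* Imported only here: the classical-set notation for [set x | P] would
   otherwise shadow the finite-set one used above. *)
From mathcomp Require Import all_classical all_reals all_analysis.
Local Open Scope classical_set_scope.

Definition prime_oo : set_system nat := within [set p | prime p] \oo.

(* Main.v *)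
Require Import Defs.
From HB Require Import structures.
From mathcomp Require Import all_boot all_order all_algebra all_fingroup.
From mathcomp Require Import all_solvable.
From mathcomp Require Import all_classical all_reals all_analysis.
From mathcomp Require Import polyXY finfield ring lra zify.
Import Order.TTheory GRing.Theory Num.Theory.
Import numFieldNormedType.Exports.
Local Open Scope classical_set_scope.
Local Open Scope ring_scope.
Set Implicit Arguments.
Unset Strict Implicit.
Unset Printing Implicit Defensive.

(** Write n = p - 1. An element of F_p is a primitive root exactly when its n-th
    power is 1 and its (n/l)-th power is not 1 for every prime l dividing n. The
    values to be counted are therefore sieved, over the primes l dividing n, out
    of the counts N_d of the x with f(x)^(n/d) = 1. If N_d = p/d + O(E)
    uniformly in d dividing n, the sieve (sieve_bound) leaves
    p * prod (1 - 1/l) = p * phi(n)/n with an error of at most 2^omega(n) * E.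
    The main term is at least p / 2^omega(n), and 4^omega(n) grows more slowly than
    any fixed power of n (omega_bound), so a saving E = O(p^(1 - delta)) for some
    delta > 0 suffices.

    Counting d-th powers (power_values_count). Let B be a small power of p. For
    d > B the equation f(x)^(n/d) = 1 has at most deg f * n/d solutions, which is
    already O(p/B). For d <= B, Stepanov's method (stepanov_bound) shows that for
    nonzero z the equation f(x)^(n/d) = z has at most p/d + O(p/(d B)) solutions.
    The solution sets for the d-th roots of unity z partition the x with f(x)
    nonzero, so the upper bounds for the z other than 1 give a lower bound for
    N_d.

    Stepanov's method. Put g = f^(n/d) and look for a polynomial
    r = sum k_ij(x) g^i x^(p j), with i < d, that vanishes to a high order at all
    x with g(x) = z. The operator f * d/dx maps such a sum to a sum of the same
    shape, because the derivative of x^(p j) is zero. At the points in question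
    g = z and x^p = x, so the vanishing conditions say that certain polynomials
    of low degree, linear in the unknown coefficients, are zero. There are more
    unknowns than conditions, hence a nonzero solution, and the degree of r
    bounds the number of points, provided that r itself is not zero.

    Why r is not zero (power_independence). One has f(x) g^d = f(x^p). As long as
    the degrees in x stay below p, x^p may be replaced by an independent variable
    y; a relation of degree less than d satisfied by g then makes the polynomial
    T^d - f(y)/f(x) share a factor of some degree h, 0 < h < d, with another
    polynomial over K(x,y). The determinant of the companion matrix of that
    factor is a w with w^d = (f(y)/f(x))^h (monic_dvdp_pure_power). Comparing
    leading coefficients in x shows that f(y)^h is a constant times a d-th power
    in K(y), so that d / gcd(d,h) > 1 divides the multiplicity of
    every irreducible factor of f over F_p.

    That last conclusion is where the hypothesis on f enters (good_reduction).
    Over Q, for every l > 1 some irreducible factor s of f has a multiplicity not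
    divisible by l, for otherwise f would be a constant times an l-th power. If
    f = s^e t with s prime to t, a Bezout identity between s and s' t persists
    modulo all large p, and yields an irreducible factor over F_p of the same
    multiplicity e. Finitely many l need this argument, as multiplicities are
    less than the size of f. *)

(** * Multiplicities of irreducible factors *)

Section Multiplicity.
Variable F : fieldType.
Implicit Types (s t u v f g : {poly F}) (a b c d e h l : nat).

Lemma exists_irreducible_factor f : (1 < size f)%N ->
  exists2 s, irreducible_poly s & s %| f.
Proof.
have [n] := ubnP (size f); elim: n f => // n IHn f lefn f_gt1.
have [[s [sn1 sf nsf]]|noproper] :=
    pselect (exists s, [/\ size s != 1%N, s %| f & ~~ (s %= f)]).
  have f0 : f != 0 by rewrite -size_poly_gt0 ltnW.
  have s0 : s != 0 by apply: contraTneq sf => ->; rewrite dvd0p.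
  have slt : (size s < size f)%N.
    by rewrite ltn_neqAle dvdp_size_eqp // nsf dvdp_leq.
  have [||w wirr ws] := IHn s; first exact: (leq_trans slt).
    by rewrite ltn_neqAle eq_sym sn1 size_poly_gt0.
  by exists w => //; exact: dvdp_trans ws sf.
exists f => //; split => // s sn1 sf; apply/negPn/negP => nsf.
by apply: noproper; exists s.
Qed.

Lemma irreducible_dvdp_mul s t u : irreducible_poly s ->
  (s %| t * u) = (s %| t) || (s %| u).
Proof.
move=> irr; have [st|nst] := boolP (s %| t); first by rewrite dvdp_mulr.
by rewrite Gauss_dvdpr // irreducible_poly_coprime.
Qed.

Lemma irreducible_dvdp_exp s t n : irreducible_poly s -> s %| t ^+ n -> s %| t.
Proof.
move=> irr; elim: n => [|n IHn].
  by rewrite expr0 dvdp1 => /eqP s1; have := irr.1; rewrite s1.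
by rewrite exprS irreducible_dvdp_mul // => /orP[].
Qed.

Definition exact_power s e f t := f = s ^+ e * t /\ ~~ (s %| t).

Lemma exact_power_exists s f : irreducible_poly s -> f != 0 ->
  exists e t, exact_power s e f t.
Proof.
move=> irr; have [n] := ubnP (size f); elim: n f => // n IHn f lefn f0.
have [sf|nsf] := boolP (s %| f); last by exists 0%N, f; rewrite /exact_power mul1r.
have [q fE] : exists q, f = s * q by exists (f %/ s); rewrite mulrC divpK.
have q0 : q != 0 by apply: contra_neq f0 => q0; rewrite fE q0 mulr0.
have [|e [t [qE nst]]] := IHn q _ q0.
  rewrite -ltnS; apply: leq_trans lefn; rewrite ltnS fE size_mul ?(irredp_neq0 irr) //.
  by have := irr.1; case: (size s) => [|[|k]] //= _; rewrite addSn /= ltnS leq_addl.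
by exists e.+1, t; split=> //; rewrite exprS -mulrA -qE.
Qed.

Lemma exact_power_inj s a b f t u : irreducible_poly s ->
  exact_power s a f t -> exact_power s b f u -> a = b.
Proof.
move=> irr.
wlog: a b t u / (a <= b)%N => [W|].
  by case/orP: (leq_total a b) => ab fa fb; [exact: (W _ _ _ _ ab fa fb)|
     apply/esym/(W _ _ _ _ ab fb fa)].
rewrite leq_eqVlt => /predU1P[//|ab [fE nst] [fE' _]].
have : s ^+ a * t = s ^+ a * (s ^+ (b - a) * u).
  by rewrite mulrA -exprD subnKC ?(ltnW ab) // -fE.
move/mulfI => -/(_ (expf_neq0 _ (irredp_neq0 irr))) tE.
case/negP: nst; rewrite tE -(subnSK ab) exprS -mulrA; exact: dvdp_mulIl.
Qed.

Lemma exact_powerM s a b f g t u : irreducible_poly s ->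
  exact_power s a f t -> exact_power s b g u ->
  exact_power s (a + b) (f * g) (t * u).
Proof.
move=> irr [-> nt] [-> nu]; split; first by rewrite mulrACA exprD.
by rewrite irreducible_dvdp_mul // negb_or nt.
Qed.

Lemma exact_powerX s a f t n : irreducible_poly s ->
  exact_power s a f t -> exact_power s (a * n) (f ^+ n) (t ^+ n).
Proof.
move=> irr [-> nt]; split; first by rewrite exprMn exprM.
by apply: contra nt; exact: irreducible_dvdp_exp.
Qed.

Lemma exact_powerZ s a f t (c : F) : c != 0 ->
  exact_power s a f t -> exact_power s a (c *: f) (c *: t).
Proof. by move=> c0 [-> nt]; split; rewrite ?scalerAr // dvdpZr. Qed.

(** Compare the multiplicities of [s] on both sides: modulo [d] only the factor
    [f ^+ h] contributes. *)
Lemma dvdn_mult_of_power_relation s e f t u v d h (c : F) :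
  irreducible_poly s -> exact_power s e f t ->
  u != 0 -> v != 0 -> c != 0 -> v ^+ d * f ^+ h = c *: u ^+ d ->
  (d %| e * h)%N.
Proof.
move=> irr fe u0 v0 c0 E.
have [a [u1 ua]] := exact_power_exists irr u0.
have [b [v1 vb]] := exact_power_exists irr v0.
have L := exact_powerM irr (exact_powerX d irr vb) (exact_powerX h irr fe).
have Rr := exact_powerZ c0 (exact_powerX d irr ua).
rewrite E in L; have := exact_power_inj irr L Rr.
by move=> E2; rewrite -(dvdn_addr _ (dvdn_mull b (dvdnn d))) E2 dvdn_mull.
Qed.

(** Split off the full power of one irreducible factor at a time; the cofactor
    inherits the hypothesis because distinct irreducible factors do not see each
    other's multiplicities. *)
Lemma const_times_power_of_mult f l : (0 < l)%N -> f != 0 ->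
  (forall s e t, irreducible_poly s -> exact_power s e f t -> (l %| e)%N) ->
  exists (c : F) g, f = c *: g ^+ l.
Proof.
move=> l0; have [n] := ubnP (size f); elim: n f => // n IHn f lefn f0 H.
have [fle1|fgt1] := leqP (size f) 1.
  exists f`_0, 1; rewrite expr1n alg_polyC; exact: size1_polyC.
have [s irr sf] := exists_irreducible_factor fgt1.
have [e [t fe]] := exact_power_exists irr f0.
have e0 : (0 < e)%N.
  by rewrite lt0n; apply: contraTneq sf => e0; case: fe => ->; rewrite e0 mul1r.
have [fE nst] := fe.
have t0 : t != 0 by apply: contra_neq f0 => t0; rewrite fE t0 mulr0.
have s0 := irredp_neq0 irr.
have [|s2 e2 t2 irr2 te|c [g tE]] := IHn t _ t0.
- rewrite -ltnS; apply: leq_trans lefn; rewrite ltnS fE size_mul ?expf_neq0 // -(prednK e0) exprS.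
  rewrite size_mul ?expf_neq0 //; have := irr.1.
  have : (0 < size (s ^+ e.-1))%N by rewrite size_poly_gt0 expf_neq0.
  by case: (size (s ^+ _)) (size s) => // k1 [|[|k]] //= _ _; rewrite !addnS !addSn /= ltnS leq_addl.
- have [->|e20] := posnP e2; first exact: dvdn0.
  apply: (H s2 e2 (s ^+ e * t2) irr2); split.
    by rewrite fE te.1 mulrCA.
  rewrite irreducible_dvdp_mul // negb_or te.2 andbT.
  apply: contra nst => /(irreducible_dvdp_exp irr2) s2s.
  have s2s' : s2 %= s by apply: irr => //; rewrite neq_ltn irr2.1 orbT.
  rewrite -(eqp_dvdl _ s2s') te.1 -(prednK e20) exprS -mulrA; exact: dvdp_mulIl.
- have /dvdnP[k eE] := H _ _ _ irr fe.
  by exists c, (s ^+ k * g); rewrite fE tE exprMn -exprM -eE scalerAr.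
Qed.

End Multiplicity.

(** * Reduction of the hypothesis modulo large primes *)

(** Gauss's lemma: clearing denominators turns the relation into one between
    integer multiples of [f] and of the [d]-th power of an integer polynomial, whose
    primitive parts must agree; the content of [f] is then the constant. *)
Lemma int_power_of_rat_power (f : {poly int}) (c : rat) (g : {poly rat}) (d : nat) :
  f != 0 -> map_poly intr f = c *: g ^+ d -> exists a h, f = a *: h ^+ d.
Proof.
move=> f0 E; have [q [a a0 gE]] := rat_poly_scale g.
have injQ : injective (map_poly (intr : int -> rat)).
  by apply: map_inj_poly => //; exact: intr_inj.
have E2 : (denq c * a ^+ d) *: f = numq c *: q ^+ d.
  apply: injQ; rewrite !map_polyZ /= E gE rmorphXn exprZn !scalerA.
  congr (_ *: _); rewrite rmorphM rmorphXn /= exprVn [_ * _ * c]mulrAC mulfK.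
    by rewrite mulrC -numqE.
  by rewrite expf_neq0 // intr_eq0.
have D0 : denq c * a ^+ d != 0 by rewrite mulf_neq0 ?denq_eq0 // expf_neq0.
have n0 : numq c != 0.
  apply: contraNneq f0 => n0.
  by rewrite -size_poly_eq0 -(size_scale f D0) E2 n0 scale0r size_poly0.
exists (zcontents f), (zprimitive q); rewrite [LHS]zpolyEprim; congr (_ *: _).
rewrite -(zprimitiveZ f D0) E2 (zprimitiveZ _ n0).
elim: (d) => [|k IHk]; last by rewrite !exprS zprimitiveM IHk.
by rewrite !expr0 zprimitive_monic // monic1.
Qed.

(** Both hypotheses are identities between polynomials, so they pass from the
    integers to any field. The Bezout identity makes [s] squarefree and prime to
    [t], hence any irreducible factor of [s] has multiplicity one in [s] and none
    in [t]. *)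
Lemma exact_power_of_certificate (K : fieldType) (f s t u v : {poly K}) (D N : K) (e : nat) :
  D != 0 -> N != 0 -> (1 < size s)%N -> D *: f = s ^+ e * t ->
  u * s + v * (s^`() * t) = N%:P ->
  exists w r, irreducible_poly w /\ exact_power w e f r.
Proof.
move=> D0 N0 s1 fE uv; have [w irr ws] := exists_irreducible_factor s1.
have nst : ~~ (w %| s^`() * t).
  apply/negP => wst; have : w %| N%:P by rewrite -uv dvdp_add // dvdp_mull.
  by move/dvdp_leq; rewrite polyC_eq0 size_polyC N0 leqNgt irr.1 => /(_ isT).
have /dvdpP[x sE] := ws.
exists w, (D^-1 *: (x ^+ e * t)); split=> //; split.
  by rewrite -scalerAr mulrA -exprMn -[w * x]mulrC -sE -fE scalerA mulVf // scale1r.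
rewrite dvdpZr ?invr_eq0 // irreducible_dvdp_mul // negb_or; apply/andP; split.
  apply: contra nst => /(irreducible_dvdp_exp irr) wx.
  by rewrite dvdp_mulr // sE derivM dvdp_add // ?dvdp_mulIr // dvdp_mulr.
by apply: contra nst => wt; rewrite dvdp_mull.
Qed.

Lemma deriv_neq0 (R : numDomainType) (s : {poly R}) : (1 < size s)%N -> s^`() != 0.
Proof.
move=> s1; apply/eqP => /(congr1 (fun u : {poly R} => u`_(size s).-2)).
rewrite coef_deriv coef0 (_ : (size s).-2.+1 = (size s).-1); last by lia.
move/eqP; rewrite mulrn_eq0 -lead_coefE lead_coef_eq0 -size_poly_eq0; lia.
Qed.

(** An irreducible factor of [f] over the rationals whose multiplicity is not
    divisible by [l] is prime to its derivative (characteristic zero) and to its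
    cofactor; scaling everything to integer coefficients costs the constants [D]
    and [N]. *)
Lemma int_certificate (f : {poly int}) (l : nat) : ~ const_times_power f -> (1 < l)%N ->
  exists (D N : int) (s t u v : {poly int}) e, [/\ D != 0, N != 0, (1 < size s)%N, ~~ (l %| e)%N &
    D *: f = s ^+ e * t /\ u * s + v * (s^`() * t) = N%:P].
Proof.
move=> nf l1; have f0 : f != 0.
  by apply/eqP => f0; apply: nf; exists 0, 0, 2%N; rewrite scale0r.
pose toQ := map_poly (intr : int -> rat).
have injQ : injective toQ by apply: map_inj_poly => //; exact: intr_inj.
have Qf0 : toQ f != 0 by rewrite -size_poly_eq0 size_rat_int_poly size_poly_eq0.
have [s [e [t [irr fe le]]]] : exists s e t,
    [/\ irreducible_poly s, exact_power s e (toQ f) t & ~~ (l %| e)%N].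
  apply: contrapT => H; apply: nf.
  have [||c [g fE]] := @const_times_power_of_mult _ (toQ f) l _ Qf0; first exact: ltnW.
    move=> s e t irr fe; apply/negPn/negP => le; apply: H; by exists s, e, t.
  have [a [h hE]] := int_power_of_rat_power f0 fE; by exists a, h, l.
have [s1 [a a0 sE]] := rat_poly_scale s.
have [t1 [b b0 tE]] := rat_poly_scale t.
have pa0 : a%:~R != 0 :> rat by rewrite intr_eq0.
have pb0 : b%:~R != 0 :> rat by rewrite intr_eq0.
have ss1 : size s1 = size s.
  by rewrite sE size_scale ?invr_eq0 // size_rat_int_poly.
have cop : coprimep (toQ s1) ((toQ s1)^`() * toQ t1).
  have : coprimep s (s^`() * t).
    rewrite irreducible_poly_coprime // irreducible_dvdp_mul // negb_or fe.2 andbT.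
    apply/negP => /dvdp_leq; rewrite -size_poly_eq0 leqNgt lt_size_deriv ?irredp_neq0 //.
    by rewrite size_poly_eq0 deriv_neq0 ?irr.1 // => /(_ isT).
  by rewrite sE tE derivZ -scalerAl -scalerAr !(coprimepZl, coprimepZr) ?invr_eq0.
have /Bezout_eq1_coprimepP[[u v] /= uv] := cop.
have [u1 [c c0 uE]] := rat_poly_scale u.
have [v1 [k k0 vE]] := rat_poly_scale v.
have pc0 : c%:~R != 0 :> rat by rewrite intr_eq0.
have pk0 : k%:~R != 0 :> rat by rewrite intr_eq0.
exists (a ^+ e * b), (c * k), s1, t1, (k *: u1), (c *: v1), e; split.
- by rewrite mulf_neq0 ?expf_neq0.
- by rewrite mulf_neq0.
- by rewrite ss1 irr.1.
- exact: le.
split; apply: injQ.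
  rewrite /toQ map_polyZ /= -/toQ fe.1 sE tE rmorphM rmorphXn /= exprZn.
  rewrite -scalerAl -scalerAr !scalerA exprVn [X in X / _]mulrAC mulfV ?expf_neq0 //.
  by rewrite mul1r mulfV // scale1r /toQ rmorphM rmorphXn.
rewrite /toQ map_polyC rmorphD !rmorphM /= !map_polyZ -deriv_map -/toQ.
rewrite -alg_polyC -uv uE vE scalerDr -!scalerAl !scalerA.
by rewrite /= intrM mulfK // [_ * _ / c%:~R]mulrAC mulfV // mul1r.
Qed.

Lemma intr_Fp_neq0 (p : nat) (z : int) : prime p -> z != 0 -> (`|z| < p)%N ->
  z%:~R != 0 :> 'F_p.
Proof.
move=> pp z0 zp; have nat_neq0 n : (0 < n < p)%N -> n%:R != 0 :> 'F_p.
  case/andP=> n0 np; rewrite -(dvdn_pcharf (pchar_Fp pp)).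
  by apply/negP => /(dvdn_leq n0); rewrite leqNgt np.
case: z z0 zp => n /= n0 np; first by rewrite nat_neq0 // lt0n n0.
by rewrite NegzE mulrNz oppr_eq0 nat_neq0.
Qed.

Definition has_exact_factor_not_dvd (K : fieldType) (f : {poly K}) (l : nat) :=
  exists s e t, [/\ irreducible_poly s, exact_power s e f t & ~~ (l %| e)%N].

(** Multiplicities are less than [size f], so a large [l] divides none of the
    positive ones. *)
Lemma large_exponent_not_dvd (K : fieldType) (f : {poly K}) (l : nat) :
  (1 < size f)%N -> (size f <= l)%N -> has_exact_factor_not_dvd f l.
Proof.
move=> f1 fl; have f0 : f != 0 by rewrite -size_poly_gt0 ltnW.
have [s irr sf] := exists_irreducible_factor f1.
have [e [t fe]] := exact_power_exists irr f0; exists s, e, t; split=> //.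
have e0 : (0 < e)%N.
  by rewrite lt0n; apply: contraTneq sf => e0; case: fe => ->; rewrite e0 mul1r.
have ltef : (e < size f)%N.
  have : s ^+ e %| f by rewrite fe.1 dvdp_mulIl.
  move/(dvdp_leq f0); apply: leq_trans.
  have := size_exp s e; have := irr.1.
  have : (0 < size (s ^+ e))%N by rewrite size_poly_gt0 expf_neq0 ?irredp_neq0.
  by move: (size _) (size _) => a b; nia.
by apply/negP => /(dvdn_leq e0); lia.
Qed.

(** The threshold has to be uniform in [l]: it is built by recursion on a bound
    for [l], beyond which [large_exponent_not_dvd] applies to every prime. *)
Lemma good_reduction (f : {poly int}) : ~ const_times_power f ->
  exists N, forall p, prime p -> (N < p)%N ->
    size (map_poly intr f : {poly 'F_p}) = size f /\
    forall l, (1 < l)%N -> has_exact_factor_not_dvd (map_poly intr f : {poly 'F_p}) l.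
Proof.
move=> nf; have f1 : (1 < size f)%N.
  rewrite ltnNge; apply/negP => /size1_polyC fE; apply: nf.
  by exists f`_0, 1, 2%N; rewrite expr1n alg_polyC.
have bounded L : exists N, forall p, prime p -> (N < p)%N -> forall l, (1 < l < L)%N ->
    has_exact_factor_not_dvd (map_poly intr f : {poly 'F_p}) l.
  elim: L => [|L [N IHL]]; first by exists 0%N => p _ _ l; rewrite ltn0 andbF.
  have [L1|L1] := leqP L 1; first by exists 0%N => p _ _ l; lia.
  have [D [M [s [t [u [v [e [D0 M0 s1 le [fE uv]]]]]]]]] := int_certificate nf L1.
  exists (N + `|D| + `|M| + `|lead_coef s|)%N => p pp Np l /andP[l1].
  rewrite ltnS leq_eqVlt => /predU1P[->|lL]; last by apply: IHL => //; lia.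
  pose r := map_poly (intr : int -> 'F_p).
  have ls0 : (lead_coef s)%:~R != 0 :> 'F_p.
    apply: intr_Fp_neq0 => //; last by lia.
    by rewrite lead_coef_eq0 -size_poly_gt0 ltnW.
  have [|||||w [x [irr fw]]] := @exact_power_of_certificate _ (r f) (r s) (r t)
      (r u) (r v) D%:~R M%:~R e.
  - by apply: intr_Fp_neq0 => //; lia.
  - by apply: intr_Fp_neq0 => //; lia.
  - by rewrite size_map_poly_id0.
  - by rewrite -map_polyZ fE rmorphM rmorphXn.
  - by rewrite deriv_map -!rmorphM -rmorphD uv /= map_polyC.
  by exists w, e, x.
(* The last summand keeps the leading coefficient alive modulo [p]. *)
have [N HN] := bounded (size f); exists (N + `|lead_coef f|)%N => p pp Np.
have sE : size (map_poly intr f : {poly 'F_p}) = size f.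
  rewrite size_map_poly_id0 //; apply: intr_Fp_neq0 => //; last exact: leq_ltn_trans (leq_addl _ _) Np.
  by rewrite lead_coef_eq0 -size_poly_gt0 ltnW.
split=> // l l1; have [lf|fl] := ltnP l (size f).
  by apply: (HN p) => //; [lia|rewrite l1].
by apply: large_exponent_not_dvd; rewrite sE.
Qed.

(** * Proper factors of a pure polynomial *)

(** By Cayley-Hamilton the companion matrix [A] of [H] satisfies [A ^+ d = a], and
    taking determinants gives the claim with [w = \det A]: up to sign, the
    constant term of [H]. *)
Lemma monic_dvdp_pure_power (L : fieldType) (a : L) (d : nat) (H : {poly L}) :
  H \is monic -> (1 < size H)%N -> H %| 'X^d - a%:P ->
  exists w, w ^+ d = a ^+ (size H).-1.
Proof.
move=> Hmon H1 Hdvd.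
have [n [A [charA sizeH]]] : exists n (A : 'M[L]_n.+1), char_poly A = H /\ size H = n.+2.
  move: (companionmx H) (companionmxK Hmon).
  case E: (size H) H1 => [|[|n]] //= _ A charA.
  by exists n; exists A.
have HA : horner_mx A ('X^d - a%:P) = 0.
  by have /dvdpP[q ->] := Hdvd; rewrite rmorphM /= -charA Cayley_Hamilton mulr0.
move: HA; rewrite rmorphB rmorphXn /= horner_mx_X horner_mx_C => /subr0_eq Ad.
exists (\det A); rewrite sizeH /= -(det_scalar n.+1 a) -Ad.
elim: (d) => [|k IHk]; first by rewrite !expr0 det1.
by rewrite !exprS detM IHk.
Qed.

Lemma fraction_num_den (R : idomainType) (w : {fraction R}) :
  exists u v : R, v != 0 /\ w = tofrac u / tofrac v.
Proof.
elim/quotW: w => x; exists (frac x).1, (frac x).2; split; first exact: denom_ratioP.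
apply: (canRL (mulfK _)); first by rewrite tofrac_eq0 denom_ratioP.
rewrite !piE; apply/eqmodP; rewrite /= FracField.equivfE /FracField.mulf.
rewrite !numden_Ratio ?mulf_neq0 ?denom_ratioP ?oner_neq0 //.
by rewrite !mulr1 mulrC.
Qed.


(** Over [L] the greatest common divisor, made monic, is a nontrivial divisor of
    [T^d - phi B / phi A] of degree less than [d]. *)
Lemma common_factor_power (R : idomainType) (L : fieldType)
    (phi : {rmorphism R -> L}) (A B : R) (d : nat) (P : {poly R}) :
  injective phi -> A != 0 -> P != 0 -> (size P <= d)%N ->
  resultant P (A *: 'X^d - B%:P) = 0 ->
  exists h w, (0 < h < d)%N /\ w ^+ d * phi A ^+ h = phi B ^+ h.
Proof.
move=> phiI A0 P0 sP; set Q := (X in resultant P X).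
have phi0 x : (phi x == 0) = (x == 0) by rewrite -(inj_eq phiI) rmorph0.
move/eqP; rewrite resultant_eq0; set H := gcdp P Q => sH.
have Hd : (size H <= d)%N := leq_trans (leq_gcdpl _ P0) sP.
have pA0 : phi A != 0 by rewrite phi0.
pose a := phi B / phi A.
have mQ : map_poly phi Q = phi A *: ('X^d - a%:P).
  rewrite /Q rmorphB /= -mul_polyC rmorphM /= !map_polyC /= map_polyXn.
  by rewrite mul_polyC scalerBr scale_polyC /a mulrC divfK.
have H0 : H != 0 by rewrite -size_poly_eq0; case: (size H) sH.
have smH : size (map_poly phi H) = size H by apply: size_map_inj_poly; rewrite ?rmorph0.
(* The gcd over a domain is defined up to constants; over [L] it can be made
   monic. *)
pose H' := (lead_coef (map_poly phi H))^-1 *: map_poly phi H.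
have lH : lead_coef (map_poly phi H) != 0.
  by rewrite lead_coef_eq0 -size_poly_eq0 smH size_poly_eq0.
have sH' : size H' = size H by rewrite size_scale ?invr_eq0.
have Hdvd : H' %| 'X^d - a%:P.
  rewrite dvdpZl ?invr_eq0 // -(dvdpZr _ _ pA0) -mQ.
  have /Pdiv.Idomain.dvdpP[[c q] /= c0 cq] : H %| Q by exact: dvdp_gcdr.
  have pc0 : phi c != 0 by rewrite phi0.
  by rewrite -(dvdpZr _ _ pc0) -map_polyZ cq rmorphM dvdp_mulIr.
have [||w] := monic_dvdp_pure_power _ _ Hdvd.
- by rewrite monicE lead_coefZ mulVf.
- by rewrite sH'.
rewrite sH' => wE; exists (size H).-1, w; split.
  by move: sH Hd; case: (size H) => [|[|k]].
by rewrite wE -exprMn divfK.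
Qed.

Lemma common_factor_power_domain (R : idomainType) (A B : R) (d : nat)
    (P : {poly R}) :
  A != 0 -> P != 0 -> (size P <= d)%N ->
  resultant P (A *: 'X^d - B%:P) = 0 ->
  exists h u v, [/\ (0 < h < d)%N, v != 0 & u ^+ d * A ^+ h = v ^+ d * B ^+ h].
Proof.
move=> A0 P0 sP res0.
have fI : injective (@FracField.tofrac R).
  by move=> x y /eqP; rewrite tofrac_eq => /eqP.
have [h [w [hd wE]]] := common_factor_power fI A0 P0 sP res0.
have [u [v [v0 uvE]]] := fraction_num_den w.
exists h, u, v; split=> //; apply: fI; rewrite !rmorphM !rmorphXn /=.
have pv0 : tofrac v ^+ d != 0 by rewrite expf_neq0 ?tofrac_eq0.
by rewrite -wE uvE expr_div_n mulrA (mulrC (tofrac v ^+ d)) divfK.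
Qed.

(** In [K[y][x]] the polynomial [f(y)] is a constant, so taking leading
    coefficients in [x] of a relation [u ^+ d * f(x) ^+ h = v ^+ d * f(y) ^+ h]
    leaves a relation in [K[y]]. *)
Lemma common_factor_power_relation (K : fieldType) (f : {poly K}) (d : nat)
    (P : {poly {poly {poly K}}}) :
  f != 0 -> P != 0 -> (size P <= d)%N ->
  resultant P (f^:P *: 'X^d - (f%:P)%:P) = 0 ->
  exists h u v (c : K), [/\ (0 < h < d)%N, u != 0, v != 0, c != 0 &
    v ^+ d * f ^+ h = c *: u ^+ d].
Proof.
move=> f0 P0 sP res0.
have fX0 : f^:P != 0 by rewrite map_polyC_eq0.
have [h [u [v [hd v0 E]]]] := common_factor_power_domain fX0 P0 sP res0.
have lfX : lead_coef f^:P = (lead_coef f)%:P.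
  by rewrite lead_coef_map_inj //; exact: polyC_inj.
exists h, (lead_coef u), (lead_coef v), ((lead_coef f) ^+ h); split=> //.
- rewrite lead_coef_eq0; apply: contraNneq v0 => u0; move/esym/eqP: E.
  have d0 : (0 < d)%N by case/andP: hd => _; apply: leq_ltn_trans.
  rewrite u0 expr0n eqn0Ngt d0 mul0r mulf_eq0 !expf_eq0 d0 /= polyC_eq0.
  by rewrite (negPf f0) andbF orbF.
- by rewrite lead_coef_eq0.
- by rewrite expf_neq0 // lead_coef_eq0.
- move/(congr1 lead_coef): E; rewrite !lead_coefM !lead_coef_exp lfX lead_coefC.
  by rewrite -rmorphXn mulrC mul_polyC => <-.
Qed.

(** * Linear independence of the powers of g over the polynomials in x and x^p *)

Lemma size_det_leq (R : comNzRingType) n (M : 'M[{poly R}]_n) (b : 'I_n -> nat) :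
  (forall i j, size (M i j) <= (b i).+1)%N -> (size (\det M) <= (\sum_i b i).+1)%N.
Proof.
move=> sM; apply: leq_trans (size_sum _ _ _) _; apply/bigmax_leqP => s _.
rewrite -[_ ^+ _]/(_ ^+ odd_perm s) mulr_sign.
have sP : (size (\prod_i M i (s i))%R <= (\sum_i b i).+1)%N.
  elim/big_ind2: _ => [|x a y c sx sy|i _]; rewrite ?size_poly1 //.
  apply: leq_trans (size_polyMleq _ _) _; rewrite -subn1 leq_subLR add1n.
  by apply: leq_trans (leq_add sx sy) _; rewrite addSn addnS.
by case: ifP; rewrite // size_polyN.
Qed.

(** In the Sylvester matrix, [(size Q).-1] rows hold coefficients of [P] and
    [(size P).-1] rows hold coefficients of [Q]. *)
Lemma size_resultant_leq (R : comNzRingType) (P Q : {poly {poly R}}) a b :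
  (forall i, size (P`_i)%R <= a.+1)%N -> (forall i, size (Q`_i)%R <= b.+1)%N ->
  (size (resultant P Q) <= ((size Q).-1 * a + (size P).-1 * b).+1)%N.
Proof.
move=> sP sQ; apply: leq_trans (@size_det_leq _ _ _
  (fun i => match fintype.split i with inl _ => a | inr _ => b end) _) _.
- move=> i j; rewrite Sylvester_mxE; case: (fintype.split i) => k;
    by rewrite mulrb; case: ifP => _; rewrite ?size_poly0 ?sP ?sQ.
- rewrite big_split_ord ltnS leq_eqVlt; apply/orP; left; apply/eqP.
  congr addn.
    rewrite (eq_bigr (fun=> a)) ?sum_nat_const ?card_ord // => i _.
    by rewrite (unsplitK (inl i)).
  rewrite (eq_bigr (fun=> b)) ?sum_nat_const ?card_ord // => i _.
  by rewrite (unsplitK (inr i)).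
Qed.

Section Independence.
Variables (K : fieldType) (q : nat).
Hypothesis q0 : (0 < q)%N.

(** The outer variable [x] goes to ['X] and the inner variable [y] to ['X^q]. *)
Definition frob_eval : {poly {poly K}} -> {poly K} :=
  horner_eval 'X \o map_poly (comp_poly 'X^q).
HB.instance Definition _ := GRing.RMorphism.on frob_eval.

Lemma frob_evalE (r : {poly {poly K}}) : frob_eval r = \sum_(k < size r) (r`_k \Po 'X^q) * 'X^k.
Proof.
rewrite /frob_eval /= /horner_eval.
rewrite (@horner_coef_wide _ (size r)); last exact: size_poly.
by apply: eq_bigr => k _; rewrite coef_map.
Qed.

(** Every exponent is [j * q + k] with [k < q] in only one way, so no two monomials
    [x ^+ k * y ^+ j] collide. *)
Lemma frob_eval_inj0 (r : {poly {poly K}}) : (size r <= q)%N -> frob_eval r = 0 -> r = 0.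
Proof.
move=> sr E; apply/polyP => k; rewrite coef0.
have [kr|kr] := ltnP k (size r); last by rewrite nth_default.
apply/polyP => j; rewrite coef0.
move/(congr1 (fun u : {poly K} => u`_(j * q + k))): E.
rewrite coef0 frob_evalE coef_sum (bigD1 (Ordinal kr)) //= big1 ?addr0.
  rewrite coefMXn ltnNge leq_addl /= addnK coef_comp_poly_Xn // dvdn_mull //.
  by rewrite mulnK.
move=> i ik; rewrite coefMXn; case: ltnP => // ile.
rewrite coef_comp_poly_Xn //; case: ifP => // dv; case/eqP: ik; apply: val_inj => /=.
have iq := leq_trans (ltn_ord i) sr; have kq := leq_trans kr sr.
by move: dv; rewrite -(eqn_mod_dvd _ ile) modnMDl !modn_small // => /eqP ->.
Qed.

Lemma frob_eval_map (f : {poly K}) : frob_eval f^:P = f.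
Proof.
rewrite /frob_eval /= /horner_eval -map_poly_comp.
rewrite (eq_map_poly (g := polyC)) => [|c]; last exact: comp_polyC.
exact: comp_polyXr.
Qed.

Lemma frob_evalC (f : {poly K}) : frob_eval f%:P = f \Po 'X^q.
Proof. by rewrite /frob_eval /= /horner_eval map_polyC hornerC. Qed.

Variables (f g : {poly K}) (d m : nat).
Hypothesis f0 : f != 0.
Hypothesis d0 : (0 < d)%N.
Hypothesis sf : (size f <= m.+1)%N.
Hypothesis fg : f * g ^+ d = f \Po 'X^q.
Hypothesis no_power : forall h u v (c : K), (0 < h < d)%N -> u != 0 -> v != 0 ->
  c != 0 -> v ^+ d * f ^+ h <> c *: u ^+ d.

(** The resultant of [P] and [f(x) T^d - f(y)] lies in the ideal they generate, so
    it vanishes at [y = 'X^q], [T = g]; its degree in [x] is less than [q], so it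
    is zero and the two polynomials have a common factor. *)
Lemma power_independence (a : nat) (P : {poly {poly {poly K}}}) :
  (size P <= d)%N -> (forall i, size (P`_i)%R <= a)%N ->
  (d * a + d * m < q)%N -> (map_poly frob_eval P).[g] = 0 -> P = 0.
Proof.
move=> sP sPi aq Pg; apply/eqP/negPn/negP => P0.
have aleq : (a <= q)%N.
  apply: leq_trans (ltnW aq); apply: leq_trans (leq_addr _ _).
  by rewrite leq_pmull.
have [sP1|sP1] := leqP (size P) 1.
  have PE := size1_polyC sP1; case/negP: P0; rewrite PE polyC_eq0; apply/eqP.
  apply: frob_eval_inj0; first exact: leq_trans aleq.
  by move: Pg; rewrite {1}PE map_polyC hornerC.
pose Q : {poly {poly {poly K}}} := f^:P *: 'X^d - (f%:P)%:P.
have fX0 : f^:P != 0 by rewrite map_polyC_eq0.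
have sQ : size Q = d.+1.
  rewrite /Q size_polyDl size_scale ?size_polyXn // size_polyN size_polyC ltnS.
  exact: leq_trans (leq_b1 _) d0.
have sQi i : (size (Q`_i)%R <= m.+1)%N.
  rewrite /Q coefB coefZ coefXn coefC; apply: leq_trans (size_polyD _ _) _.
  rewrite geq_max size_polyN; apply/andP; split.
    by case: eqP => _; rewrite ?mulr1 ?mulr0 ?size_poly0 // size_map_polyC.
  case: eqP => _; rewrite ?size_poly0 //.
  by apply: leq_trans (size_polyC_leq1 _) _.
have Qg : (map_poly frob_eval Q).[g] = 0.
  rewrite /Q rmorphB /= -mul_polyC rmorphM /= !map_polyC /= map_polyXn.
  by rewrite !hornerE frob_eval_map frob_evalC fg subrr.
have sQ1 : (1 < size Q)%N by rewrite sQ.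
have [[U V] /= _ UV] := resultant_in_ideal sP1 sQ1.
have res0 : resultant P Q = 0.
  apply: frob_eval_inj0.
    apply: leq_trans (size_resultant_leq (a := a) (b := m) _ sQi) _.
      by move=> i; apply: leq_trans (leqnSn _).
    rewrite sQ /=; apply: leq_ltn_trans aq; rewrite leq_add2l leq_mul2r.
    by rewrite (leq_trans (leq_pred _)) ?orbT.
  have := congr1 (fun z => (map_poly frob_eval z).[g]) UV.
  by rewrite map_polyC hornerC rmorphD !rmorphM /= !hornerE Pg Qg !mulr0 addr0.
have [h [u [v [c [hd u0 v0 c0]]]]] := common_factor_power_relation f0 P0 sP res0.
exact: no_power.
Qed.

End Independence.

(** * Vanishing of high order *)

Lemma prod_XsubC_exp_dvdp (K : fieldType) (s : seq K) (n : nat) (r : {poly K}) :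
  uniq s -> (forall x, x \in s -> ('X - x%:P) ^+ n %| r) ->
  \prod_(x <- s) ('X - x%:P) ^+ n %| r.
Proof.
elim: s => [|x s IHs] /=; first by rewrite big_nil dvd1p.
case/andP=> xs us H; rewrite big_cons Gauss_dvdp.
  by rewrite H ?mem_head // IHs // => y ys; apply: H; rewrite inE ys orbT.
apply: coprimep_expl; rewrite big_seq.
elim/big_ind: _ => [|u v|y ys]; first exact: coprimep1.
  by rewrite coprimepMr => -> ->.
apply: coprimep_expr; apply: coprimep_XsubC2; rewrite subr_eq0.
by apply: contraNneq xs => <-.
Qed.

Lemma multiple_roots_leq (K : fieldType) (s : seq K) (n : nat) (r : {poly K}) :
  r != 0 -> uniq s -> (forall x, x \in s -> ('X - x%:P) ^+ n %| r) ->
  (n * size s < size r)%N.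
Proof.
move=> r0 us H; have := dvdp_leq r0 (prod_XsubC_exp_dvdp us H).
rewrite prodrXl; have := size_exp (\prod_(x <- s) ('X - x%:P)) n.
rewrite size_prod_XsubC /= mulnC => <-; apply: leq_trans.
by rewrite ltn_predL size_poly_gt0 expf_neq0 // -size_poly_gt0 size_prod_XsubC.
Qed.

Section Derivation.
Variables (K : fieldType) (p : nat).
Hypothesis charKp : p \in [pchar K].
Variable f : {poly K}.

(** Multiplying the derivation by [f] avoids the division by [f] in the
    logarithmic derivative of a power of [f]. *)
Definition theta (r : {poly K}) := f * r^`().

(** Each application of [theta f] lowers the order of the zero by one and multiplies
    the leading term by a positive integer less than [p] times [f.[x]], both
    nonzero in [K]. *)
Lemma theta_iter_root (x : K) (l : nat) (u : {poly K}) : f.[x] != 0 -> (l < p)%N ->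
  root (iter l theta (('X - x%:P) ^+ l * u)) x -> root u x.
Proof.
move=> fx; elim: l u => [|l IHl] u lp; first by rewrite /= mul1r.
have -> : iter l.+1 theta (('X - x%:P) ^+ l.+1 * u) =
    iter l theta (('X - x%:P) ^+ l * (f * (u *+ l.+1 + ('X - x%:P) * u^`()))).
  rewrite iterSr; congr (iter _ _ _); rewrite /theta derivM deriv_exp derivXsubC /=.
  by rewrite exprS; ring.
move/(IHl _ (ltnW lp)); rewrite !rootE !hornerE subrr mul0r addr0 hornerMn.
rewrite -mulr_natr !mulf_eq0 (negPf fx) /= => /orP[//|].
rewrite -(dvdn_pcharf charKp) => /dvdn_leq; lia.
Qed.

Lemma theta_vanishing_dvdp (x : K) (n : nat) (r : {poly K}) : f.[x] != 0 -> (n <= p)%N ->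
  (forall l, (l < n)%N -> root (iter l theta r) x) -> ('X - x%:P) ^+ n %| r.
Proof.
move=> fx; elim: n => [|n IHn] np H; first by rewrite dvd1p.
have /dvdpP[u rE] := IHn (ltnW np) (fun l ln => H l (ltnW ln)).
have := H n (ltnSn n); rewrite rE mulrC => /(theta_iter_root fx np).
rewrite root_factor_theorem => /dvdpP[v ->].
by rewrite mulrCA -exprSr dvdp_mulIr.
Qed.

End Derivation.

(** * Stepanov's auxiliary polynomial *)

Section Stepanov.
Variables (F : finFieldType) (p : nat).
Hypothesis charFp : p \in [pchar F].
Hypothesis cardF : #|F| = p.
Variables (f : {poly F}) (d e m : nat).
Hypothesis de : (d * e)%N = p.-1.
Hypothesis d0 : (0 < d)%N.
Hypothesis f0 : f != 0.
Hypothesis sf : (size f <= m.+1)%N.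

Let g := f ^+ e.

Let prime_p : prime p. Proof. exact: pcharf_prime charFp. Qed.
Let p_gt0 : (0 < p)%N. Proof. exact: prime_gt0 prime_p. Qed.

(** The left side is [f ^+ p], and Frobenius fixes the coefficients of [f]. *)
Lemma mul_power_comp_Xp : f * g ^+ d = f \Po 'X^p.
Proof.
rewrite /g -exprM mulnC de -exprS prednK ?p_gt0 // comp_polyE.
have cP : p \in [pchar {poly F}] by rewrite pchar_lalg.
rewrite -{1}(coefK f) poly_def -(pFrobenius_autE cP) rmorph_sum /=.
apply: eq_bigr => i _; rewrite pFrobenius_autE exprZn -!exprM mulnC.
by rewrite -[in X in X *: _]cardF expf_card.
Qed.

(** The action of [theta f] on the coefficient [k] of [g ^+ n]. *)
Definition twisted_theta n (k : {poly F}) := f * k^`() + (f^`() * k) *+ (n * e).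

Lemma twisted_thetaB n : {morph twisted_theta n : x y / x - y}.
Proof. by move=> x y; rewrite /twisted_theta derivB; ring. Qed.

Lemma iter_twisted_thetaB n l :
  {morph iter l (twisted_theta n) : x y / x - y}.
Proof. by elim: l => [|l IHl] x y //=; rewrite IHl twisted_thetaB. Qed.

Lemma theta_term n j k : theta f (k * g ^+ n * 'X^(p * j)) =
  twisted_theta n k * g ^+ n * 'X^(p * j).
Proof.
have dX : ('X^(p * j))^`() = 0 :> {poly F}.
  by rewrite derivXn -mulr_natr natrM (pcharf0 _) ?pchar_lalg // mul0r mulr0.
have dg : f * (g ^+ n)^`() = f^`() * g ^+ n *+ (n * e).
  rewrite /g -!exprM deriv_exp mulnC; case: (n * e)%N => [|k']; first by rewrite !mulr0n mulr0.
  by rewrite /= exprS mulrnAr mulrCA.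
rewrite /theta /twisted_theta !derivM dX mulr0 addr0 mulrA mulrDr (mulrCA f k) dg.
rewrite -(mulr_natr (f^`() * g ^+ n)) -(mulr_natr (f^`() * k)).
by move: (_%:R) => u; ring.
Qed.

Lemma size_twisted_theta n k : (size (twisted_theta n k) <= size k + m)%N.
Proof.
have [->|k0] := eqVneq k 0.
  by rewrite /twisted_theta deriv0 !mulr0 mul0rn addr0 size_poly0.
have k1 : (0 < size k)%N by rewrite size_poly_gt0.
have sk' : (size k^`() < size k)%N by exact: lt_size_deriv.
have sf' : (size f^`() < size f)%N by exact: lt_size_deriv.
apply: leq_trans (size_polyD _ _) _; rewrite geq_max; apply/andP; split.
  apply: leq_trans (size_polyMleq _ _) _; lia.
rewrite -scaler_nat; apply: leq_trans (size_scale_leq _ _) _.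
by apply: leq_trans (size_polyMleq _ _) _; lia.
Qed.

Variables (a J : nat).
Implicit Types c : {ffun 'I_d * 'I_J * 'I_a -> F}.

Definition block c i j : {poly F} := \sum_(k < a) c (i, j, k) *: 'X^k.

Definition auxiliary c : {poly F} :=
  \sum_(i < d) \sum_(j < J) block c i j * g ^+ i * 'X^(p * j).

(** The value of [iter l (theta f) (auxiliary c)] after substituting [z] for [g] and
    ['X] for ['X^p], which is legitimate at the points where [g] takes the value
    [z]. Unlike that derivative it has low degree. *)
Definition reduced_derivative (z : F) c l : {poly F} :=
  \sum_(i < d) \sum_(j < J)
     iter l (twisted_theta i) (block c i j) * (z ^+ i)%:P * 'X^j.

Lemma size_block c i j : (size (block c i j) <= a)%N.
Proof.
apply: leq_trans (size_sum _ _ _) _; apply/bigmax_leqP => k _.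
by apply: leq_trans (size_scale_leq _ _) _; rewrite size_polyXn.
Qed.

Lemma iter_theta_auxiliary c l : iter l (theta f) (auxiliary c) =
  \sum_(i < d) \sum_(j < J)
     iter l (twisted_theta i) (block c i j) * g ^+ i * 'X^(p * j).
Proof.
elim: l => [|l IHl] //=; rewrite IHl /theta raddf_sum mulr_sumr.
apply: eq_bigr => i _; rewrite raddf_sum mulr_sumr.
by apply: eq_bigr => j _; exact: theta_term.
Qed.

Lemma iter_theta_auxiliary_eval c l x :
  (iter l (theta f) (auxiliary c)).[x] = (reduced_derivative g.[x] c l).[x].
Proof.
rewrite iter_theta_auxiliary !horner_sum; apply: eq_bigr => i _.
rewrite !horner_sum; apply: eq_bigr => j _.
by rewrite !hornerE exprM -[in x ^+ p]cardF expf_card.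
Qed.

Lemma size_reduced_derivative z c l :
  (size (reduced_derivative z c l) <= a + l * m + J)%N.
Proof.
apply: leq_trans (size_sum _ _ _) _; apply/bigmax_leqP => i _.
apply: leq_trans (size_sum _ _ _) _; apply/bigmax_leqP => j _.
apply: leq_trans (size_polyMleq _ _) _; rewrite size_polyXn addnS /=.
apply: leq_add; last exact: ltnW.
apply: leq_trans (size_polyMleq _ _) _.
have := size_polyC_leq1 (z ^+ i).
have : (size (iter l (twisted_theta i) (block c i j)) <= a + l * m)%N.
  elim: l => [|l IHl]; first by rewrite addn0 size_block.
  apply: leq_trans (size_twisted_theta _ _) _.
  by apply: leq_trans (leq_add IHl (leqnn m)) _; rewrite mulSn; lia.
lia.
Qed.

Lemma blockB c c' i j : block (c - c') i j = block c i j - block c' i j.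
Proof.
by rewrite /block -sumrB; apply: eq_bigr => k _; rewrite !ffunE scalerBl.
Qed.

Lemma reduced_derivativeB z c c' l : reduced_derivative z (c - c') l =
  reduced_derivative z c l - reduced_derivative z c' l.
Proof.
rewrite /reduced_derivative -sumrB; apply: eq_bigr => i _.
rewrite -sumrB; apply: eq_bigr => j _.
by rewrite blockB iter_twisted_thetaB !mulrBl.
Qed.

(** Pigeonhole: there are more coefficient vectors than values of the coefficients
    of the [n] reduced derivatives, so two vectors agree on all of them, and their
    difference does the job. *)
Lemma exists_auxiliary (z : F) (n : nat) : (n * (a + n * m + J) < d * J * a)%N ->
  exists2 c, c != 0 & forall l, (l < n)%N -> reduced_derivative z c l = 0.
Proof.
move=> lt_cond; pose w := (a + n * m + J)%N.
(* [L] lists the coefficients of the first [n] reduced derivatives. *)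
pose L c : {ffun 'I_n * 'I_w -> F} := [ffun lk : 'I_n * 'I_w => (reduced_derivative z c lk.1)`_lk.2].
have /injectivePn[c [c' cc' Lcc']] : ~~ injectiveb L.
  apply/injectiveP => Linj; have := leq_card L Linj.
  rewrite !card_ffun !card_prod !card_ord cardF leq_exp2l ?prime_gt1 ?prime_p //.
  by rewrite leqNgt lt_cond.
exists (c - c'); first by rewrite subr_eq0.
move=> l ln; rewrite reduced_derivativeB; apply/polyP => k.
rewrite coefB coef0; have [kw|kw] := ltnP k w.
  have := congr1 (fun u : {ffun _ -> F} => u (Ordinal ln, Ordinal kw)) Lcc'.
  by rewrite !ffunE /= => ->; rewrite subrr.
have lw : (a + l * m + J <= w)%N by rewrite /w; nia.
by rewrite !nth_default ?subrr //; apply: leq_trans (leq_trans lw kw);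
  exact: size_reduced_derivative.
Qed.

Lemma size_auxiliary c : (size (auxiliary c) <= a + p * m + p * J)%N.
Proof.
apply: leq_trans (size_sum _ _ _) _; apply/bigmax_leqP => i _.
apply: leq_trans (size_sum _ _ _) _; apply/bigmax_leqP => j _.
apply: leq_trans (size_polyMleq _ _) _; rewrite size_polyXn addnS /=.
apply: leq_add; last by rewrite leq_mul2l orbC ltnW.
apply: leq_trans (size_polyMleq _ _) _.
have := size_block c i j.
have : (size (g ^+ i) <= (e * i * m).+1)%N.
  rewrite /g -exprM; apply: leq_trans (size_poly_exp_leq _ _) _.
  by rewrite ltnS mulnC leq_mul2l; apply/orP; right; move: sf; lia.
have : (e * i <= p)%N.
  by apply: leq_trans (leq_pred p); rewrite -de mulnC leq_mul2r ltnW ?orbT.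
by move: (size _) (size _) => s1 s2; nia.
Qed.

Hypothesis no_power : forall h u v (c : F), (0 < h < d)%N -> u != 0 -> v != 0 ->
  c != 0 -> v ^+ d * f ^+ h <> c *: u ^+ d.

(** [auxiliary c] is the value at [x = 'X], [y = 'X^p], [T = g] of a polynomial [P]
    in [K[y][x][T]] whose coefficients are those of [c]. *)
Lemma auxiliary_neq0 c : (d * a + d * m < p)%N -> c != 0 -> auxiliary c != 0.
Proof.
move=> small; apply: contra_neq => aux0.
pose inner i k : {poly F} := \sum_(j < J) c (i, j, k) *: 'X^j.
pose P : {poly {poly {poly F}}} :=
  \sum_(i < d) (\sum_(k < a) inner i k *: 'X^k) *: 'X^i.
have coefP (i : 'I_d) : P`_i = \sum_(k < a) inner i k *: 'X^k.
  rewrite /P coef_sum (bigD1 i) //= coefZ coefXn eqxx mulr1 [X in _ + X]big1 ?addr0 //.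
  by move=> i' ii'; rewrite coefZ coefXn eq_sym val_eqE (negPf ii') mulr0.
have P0 : P = 0.
  have sP : (size P <= d)%N.
    apply: leq_trans (size_sum _ _ _) _; apply/bigmax_leqP => i _.
    by apply: leq_trans (size_scale_leq _ _) _; rewrite size_polyXn.
  apply: (power_independence p_gt0 f0 d0 sf mul_power_comp_Xp no_power sP _ small).
    move=> i; have [id|id] := ltnP i d; last first.
      by rewrite nth_default ?size_poly0 //; exact: leq_trans id.
    rewrite (coefP (Ordinal id)); apply: leq_trans (size_sum _ _ _) _.
    apply/bigmax_leqP => k _.
    by apply: leq_trans (size_scale_leq _ _) _; rewrite size_polyXn.
  rewrite -aux0 /P rmorph_sum horner_sum; apply: eq_bigr => i _ /=.
  rewrite map_polyZ map_polyXn !hornerE rmorph_sum mulr_suml /=.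
  transitivity (\sum_(k < a) \sum_(j < J) c (i, j, k) *: 'X^k * 'X^(p * j) * g ^+ i).
    apply: eq_bigr => k _; rewrite -mul_polyC rmorphM /= frob_evalC.
    rewrite -(map_polyXn polyC) frob_eval_map rmorph_sum /= mulr_suml mulr_suml.
    apply: eq_bigr => j _; rewrite linearZ /= comp_Xn_poly -exprM.
    by rewrite -!scalerAl [_ * 'X^k]mulrC.
  rewrite exchange_big /=; apply: eq_bigr => j _.
  rewrite /block !mulr_suml; apply: eq_bigr => k _.
  by rewrite mulrAC.
apply/ffunP => -[[i j] k]; rewrite ffunE.
have := coefP i; rewrite P0 coef0 => /esym/(congr1 (fun u : {poly {poly F}} => u`_k)).
rewrite coef0 coef_sum (bigD1 k) //= coefZ coefXn eqxx mulr1 [X in _ + X]big1 ?addr0; last first.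
  by move=> k' kk'; rewrite coefZ coefXn eq_sym val_eqE (negPf kk') mulr0.
move=> /(congr1 (fun u : {poly F} => u`_j)).
rewrite coef0 coef_sum (bigD1 j) //= coefZ coefXn eqxx mulr1 [X in _ + X]big1 ?addr0 //.
by move=> j' jj'; rewrite coefZ coefXn eq_sym val_eqE (negPf jj') mulr0.
Qed.

(** [auxiliary c] has a zero of order [n] at each of the points, and its degree is
    of order [p * J]. With [n] close to [d * J] this is nearly the expected count
    [p / d]. *)
Lemma stepanov_bound (z : F) (n : nat) : (n <= p)%N -> (d * a + d * m < p)%N ->
  (n * (a + n * m + J) < d * J * a)%N -> z != 0 -> (0 < e)%N ->
  (n * #|[pred x | f.[x] ^+ e == z]| < a + p * m + p * J)%N.
Proof.
move=> np small lt_cond z0 e0.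
have [c c0 cond] := exists_auxiliary z lt_cond.
rewrite cardE; apply: leq_trans (size_auxiliary c).
apply: multiple_roots_leq; [exact: auxiliary_neq0|exact: enum_uniq|].
move=> x; rewrite mem_enum inE => /eqP fxz.
apply: (theta_vanishing_dvdp charFp (f := f)) => //.
  by apply: contraNneq z0 => fx0; rewrite -fxz fx0 expr0n eqn0Ngt e0.
move=> l ln; rewrite rootE iter_theta_auxiliary_eval.
by rewrite /g horner_exp fxz cond // horner0.
Qed.

End Stepanov.

(** * Counting the values that are d-th powers *)

(** A relation would force [d %/ gcdn d h], which exceeds 1 because [h < d], to
    divide the multiplicity of every irreducible factor of [f]. *)
Lemma no_power_relation (K : fieldType) (f : {poly K}) (d : nat) :
  (forall l, (1 < l)%N -> has_exact_factor_not_dvd f l) ->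
  forall h u v (c : K), (0 < h < d)%N -> u != 0 -> v != 0 -> c != 0 ->
  v ^+ d * f ^+ h <> c *: u ^+ d.
Proof.
move=> H h u v c /andP[h0 hd] u0 v0 c0 E.
have d0 : (0 < d)%N by exact: leq_trans hd.
have g0 : (0 < gcdn d h)%N by rewrite gcdn_gt0 d0.
have l1 : (1 < d %/ gcdn d h)%N.
  rewrite ltn_divRL ?dvdn_gcdl // mul1n; apply: leq_ltn_trans hd.
  by rewrite dvdn_leq // dvdn_gcdr.
have [s [e [t [irr fe /negP]]]] := H _ l1; apply.
have dv := dvdn_mult_of_power_relation irr fe u0 v0 c0 E.
have cop : coprime (d %/ gcdn d h) (h %/ gcdn d h).
  rewrite /coprime -(eqn_pmul2r g0) muln_gcdl !divnK ?dvdn_gcdl ?dvdn_gcdr //.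
  by rewrite mul1n.
rewrite -(Gauss_dvdl _ cop) -(dvdn_pmul2r g0) -mulnA !divnK //.
  exact: dvdn_gcdr.
exact: dvdn_gcdl.
Qed.

Section PowerClasses.
Variables (F : finFieldType) (p : nat).
Hypothesis charFp : p \in [pchar F].
Hypothesis cardF : #|F| = p.
Variables (f : {poly F}) (m : nat).
Hypothesis f1 : (1 < size f)%N.
Hypothesis sf : (size f <= m.+1)%N.
Hypothesis fH : forall l, (1 < l)%N -> has_exact_factor_not_dvd f l.

Let f0 : f != 0. Proof. by rewrite -size_poly_gt0 ltnW. Qed.
Let p_prime : prime p. Proof. exact: pcharf_prime charFp. Qed.

Definition power_class e z := #|[pred x | f.[x] ^+ e == z]|.

(** The parameters of [stepanov_bound] are [n = d * B] and [J = B.+1], so that there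
    are [d * a] more unknowns than [n * a]; then [a] is the least value for which
    this surplus pays for the remaining conditions. *)
Lemma power_class_leq d e B z :
  (d * e)%N = p.-1 -> (0 < d <= B)%N ->
  (B * (B * (B * B * m + B + 1) + 1) + B * m < p)%N -> z != 0 ->
  (d * B * power_class e z < (B * (d * B * m + B + 1)).+1 + p * m + p * B.+1)%N.
Proof.
move=> de /andP[d0 dB] small z0; pose a := (B * (d * B * m + B + 1)).+1.
have e0 : (0 < e)%N.
  by have := prime_gt1 p_prime; rewrite lt0n; apply: contraTneq => e0;
    move: de; rewrite e0 muln0; lia.
have aB : (a <= B * (B * B * m + B + 1) + 1)%N.
  by rewrite /a !addn1 ltnS leq_mul2l ltnS leq_add2r !leq_mul2r dB !orbT.
apply: (stepanov_bound charFp cardF de d0 f0 sf (no_power_relation fH)) => //.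
- by have : (d * B <= B * B)%N; [rewrite leq_mul2r dB orbT|nia].
- apply: leq_ltn_trans small; apply: leq_add; last by rewrite leq_mul2r dB orbT.
  exact: leq_mul.
- have : (d * B * (d * B * m + B.+1) < d * a)%N.
    by rewrite -[(d * B * _)%N]mulnA ltn_pmul2l // /a -addnA addn1 ltnSn.
  rewrite (_ : d * B.+1 * a = d * B * a + d * a)%N; last by rewrite mulnS mulnDl addnC.
  have aux (x w y z' t : nat) : (w * (y + z') < t -> w * (x + y + z') < w * x + t)%N.
    by rewrite -addnA [(w * (x + _))%N]mulnDr ltn_add2l.
  exact: aux.
Qed.

Lemma card_nonzero_values : (p <= m + #|[pred x | f.[x] != 0%R]|)%N.
Proof.
rewrite -cardF -(cardC [pred x | f.[x] != 0]) addnC leq_add2r.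
rewrite cardE -ltnS; apply: leq_trans sf; apply: max_poly_roots => //.
  by apply/allP => x; rewrite mem_enum !inE negbK.
exact: enum_uniq.
Qed.

Lemma card_unity_roots_pred d : (0 < d)%N -> (#|[pred z : F | z ^+ d == 1%R & z != 1%R]| < d)%N.
Proof.
move=> d0; have : (#|[pred z : F | z ^+ d == 1%R]| <= d)%N.
  rewrite cardE; apply: max_unity_roots => //; last exact: enum_uniq.
  by apply/allP => x; rewrite mem_enum !inE unity_rootE.
apply: leq_trans; rewrite [X in (_ <= X)%N](cardD1 1) inE expr1n eqxx /= ltnS.
by apply: subset_leq_card; apply/fintype.subsetP => x; rewrite !inE andbC.
Qed.

Lemma nonzero_values_split d e : (d * e)%N = p.-1 ->
  (#|[pred x | f.[x] != 0%R]| <= power_class e 1%R +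
     \sum_(z : F | (z ^+ d == 1%R) && (z != 1%R)) power_class e z)%N.
Proof.
move=> de; rewrite -sum1_card (partition_big (fun x => f.[x] ^+ e) (fun z => z ^+ d == 1)) /=.
  rewrite (bigD1 1) ?expr1n //=; apply: leq_add; [|apply: leq_sum => z _];
    by rewrite sum1_card; apply: subset_leq_card; apply/fintype.subsetP => x;
       rewrite !inE => /andP[].
move=> x; rewrite inE => fx; rewrite -exprM mulnC de; apply/eqP/(mulfI fx).
by rewrite mulr1 -exprS prednK ?prime_gt0 // -[in X in _ ^+ X]cardF expf_card.
Qed.

(** For [d <= B] the upper bound is [power_class_leq], and the lower bound is what
    the other [d.-1] classes leave of the nonzero values; the losses are [m] for
    the roots of [f] and [(m + 2) * p / B] for the classes. For [d > B] both terms
    of the difference are small. *)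
Lemma power_values_count (R : realFieldType) d B : (d %| p.-1)%N -> (0 < B)%N ->
  (B * (B * (B * B * m + B + 1) + 1) + B * m < p)%N ->
  `|(power_class (p.-1 %/ d) 1)%:R - p%:R / d%:R| <= (2 * m + 2)%:R * p%:R / B%:R :> R.
Proof.
move=> dp B0 small; set e := (p.-1 %/ d)%N.
have p1 := prime_gt1 p_prime.
have n0 : (0 < p.-1)%N by lia.
have d0 : (0 < d)%N by exact: dvdn_gt0 dp.
have de : (d * e)%N = p.-1 by rewrite /e mulnC divnK.
have e0 : (0 < e)%N by move: n0; rewrite -de muln_gt0 => /andP[].
have B0R : 0 < B%:R :> R by rewrite ltr0n.
have d0R : 0 < d%:R :> R by rewrite ltr0n.
rewrite ler_distl; set N := power_class e 1.
have [dB|Bd] := leqP d B; last first.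
  have Nle : (N <= m * e)%N.
    have sfe : size (f ^+ e) = ((size f).-1 * e).+1.
      by rewrite -size_exp prednK // size_poly_gt0 expf_neq0.
    have sfe1 : (1 < size (f ^+ e))%N by rewrite sfe ltnS muln_gt0 e0 -subn1 subn_gt0 f1.
    have sP : size (f ^+ e - 1) = size (f ^+ e).
      by rewrite size_polyDl // size_polyN size_poly1.
    rewrite /N /power_class cardE -ltnS; apply: leq_trans (_ : size (f ^+ e - 1)%R <= _)%N.
      apply: max_poly_roots; last exact: enum_uniq.
        by rewrite -size_poly_gt0 sP ltnW.
      by apply/allP => x; rewrite mem_enum inE rootE !hornerE subr_eq0.
    by rewrite sP sfe ltnS leq_mul2r -ltnS prednK ?sf ?orbT // ltnW.
  have NB : (N * B <= m * p)%N.
    apply: leq_trans (_ : m * e * d <= _)%N; first by rewrite leq_mul // ltnW.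
    by rewrite -mulnA leq_mul2l mulnC de leq_pred orbT.
  have NBR : N%:R <= m%:R * p%:R / B%:R :> R.
    by rewrite ler_pdivlMr // -!natrM ler_nat.
  have pdB : p%:R / d%:R <= p%:R / B%:R :> R.
    by rewrite ler_wpM2l // lef_pV2 ?posrE // ler_nat ltnW.
  have pd0 : 0 <= p%:R / d%:R :> R by rewrite divr_ge0.
  have pB0 : 0 <= p%:R / B%:R :> R by rewrite divr_ge0.
  have mpB0 : 0 <= m%:R * p%:R / B%:R :> R by rewrite !mulr_ge0 ?invr_ge0.
  have -> : (2 * m + 2)%:R * p%:R / B%:R =
      2%:R * (m%:R * p%:R / B%:R) + 2%:R * (p%:R / B%:R) :> R.
    by rewrite natrD natrM !mulrDl -!mulrA.
  move: pdB pd0 pB0 mpB0 NBR; set x := p%:R / d%:R; set y := p%:R / B%:R.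
  have N0 : 0 <= N%:R :> R by [].
  by move: N0; move: (m%:R * p%:R / B%:R) (N%:R) => t u; lra.
(* [T] bounds [d * B] times the size of each class. *)
pose T := ((B * (d * B * m + B + 1)).+1 + p * m + p * B.+1)%N.
have dB' : (0 < d <= B)%N by rewrite d0.
have cls z : z != 0 -> (d * B * power_class e z <= T)%N.
  by move=> z0; rewrite ltnW // power_class_leq.
have up := cls 1 (oner_neq0 _).
have lo : (d * B * p <= d * B * m + d * B * N + d.-1 * T)%N.
  apply: leq_trans (_ : d * B * (m + (N +
     \sum_(z : F | (z ^+ d == 1%R) && (z != 1%R)) power_class e z)) <= _)%N.
    rewrite leq_mul2l; apply/orP; right; apply: leq_trans card_nonzero_values _.
    by rewrite leq_add2l nonzero_values_split.
  rewrite mulnDr mulnDr addnA leq_add2l big_distrr /=.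
  apply: leq_trans (_ : \sum_(z : F | (z ^+ d == 1%R) && (z != 1%R)) T <= _)%N.
    apply: leq_sum => z /andP[zd _]; apply: cls.
    by apply: contraTneq zd => ->; rewrite expr0n eqn0Ngt d0 eq_sym oner_neq0.
  rewrite sum_nat_const leq_mul2r -ltnS prednK //.
  by rewrite card_unity_roots_pred ?orbT.
have TB : (T <= p * B + (m + 2) * p)%N.
  suff : ((B * (d * B * m + B + 1)).+1 <= p)%N by rewrite /T; nia.
  apply: leq_ltn_trans small; apply: leq_trans (leq_addr _ _).
  apply: leq_trans (_ : B * (B * B * m + B + 1) + 1 <= _)%N; last exact: leq_pmull.
  by apply: leq_trans (leq_addr _ _); rewrite leq_mul2l !leq_add2r !leq_mul2r dB !orbT.
have Bp : (B <= p)%N.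
  by apply: leq_trans (ltnW small); apply: leq_trans (leq_addr _ _); apply: leq_pmulr; rewrite addn1.
have dBp : 0 < d%:R * B%:R :> R by rewrite mulr_gt0.
have upR : d%:R * B%:R * N%:R <= p%:R * B%:R + (m + 2)%:R * p%:R :> R.
  by rewrite -!natrM -natrD ler_nat; exact: leq_trans up TB.
have lowR : p%:R * B%:R <= d%:R * B%:R * N%:R + d%:R * ((2 * m + 2)%:R * p%:R) :> R.
  rewrite -!natrM -!natrD ler_nat; move: lo TB Bp d0; case: (d) => // k.
  rewrite succnK; move: (T) => t lo TB Bp _.
  have := leq_mul (leqnn k) TB; have : (k.+1 * (B * m) <= k.+1 * (p * m))%N.
    by rewrite !leq_mul2l !leq_mul2r Bp !orbT.
  have : (k * ((m + 2) * p) <= k.+1 * ((m + 2) * p))%N by rewrite leq_mul2r leqnSn orbT.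
  by move: lo; move: (m) (N) => m' N'; lia.
apply/andP; split; rewrite -(ler_pM2l dBp).
  have -> : d%:R * B%:R * (p%:R / d%:R - (2 * m + 2)%:R * p%:R / B%:R) =
      p%:R * B%:R - d%:R * ((2 * m + 2)%:R * p%:R) :> R.
    by field; rewrite !gt_eqF.
  by rewrite lerBlDr.
have -> : d%:R * B%:R * (p%:R / d%:R + (2 * m + 2)%:R * p%:R / B%:R) =
    p%:R * B%:R + d%:R * ((2 * m + 2)%:R * p%:R) :> R.
  by field; rewrite !gt_eqF.
apply: le_trans upR _; rewrite lerD2l -!natrM ler_nat.
rewrite -[X in (X <= _)%N]mul1n leq_mul // leq_mul2r; lia.
Qed.

End PowerClasses.

(** * The sieve over the primes dividing p - 1 *)

Lemma expr_gcdn_eq1 (K : fieldType) (z : K) a b : (0 < a)%N ->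
  (z ^+ gcdn a b == 1) = (z ^+ a == 1) && (z ^+ b == 1).
Proof.
move=> a0; apply/eqP/andP => [zg|[/eqP za /eqP zb]].
  have pow c : (gcdn a b %| c)%N -> z ^+ c == 1.
    by case/dvdnP => k ->; rewrite mulnC exprM zg expr1n.
  by rewrite !pow ?dvdn_gcdl ?dvdn_gcdr.
have [k _ /dvdnP[j kE]] := Bezoutl b a0.
have : z ^+ (gcdn a b + k * b) = 1 by rewrite kE mulnC exprM za expr1n.
by rewrite exprD mulnC exprM zb expr1n mulr1.
Qed.

Section Sieve.
Variables (R : realFieldType) (T : finType) (K : fieldType) (y : T -> K) (n : nat).
Hypothesis n0 : (0 < n)%N.

Definition sifted d s :=
  #|[pred t | (y t ^+ (n %/ d) == 1) && all (fun l => y t ^+ (n %/ l) != 1) s]|.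

(** For coprime [d] and [l], being a [d]-th and an [l]-th power is the same as being
    a [d * l]-th power. *)
Lemma sifted_cons d l s : coprime d l -> (d * l %| n)%N ->
  (sifted d s = sifted d (l :: s) + sifted (d * l) s)%N.
Proof.
move=> cdl /dvdnP[k nE]; rewrite /sifted.
have k0 : (0 < k)%N by move: n0; rewrite nE muln_gt0 => /andP[].
have /andP[d0 l0] : ((0 < d) && (0 < l))%N.
  by move: n0; rewrite nE !muln_gt0 => /andP[].
have nd : (n %/ d = k * l)%N by rewrite nE mulnA mulnAC mulnK.
have nl : (n %/ l = k * d)%N by rewrite nE mulnA mulnK.
have ndl : (n %/ (d * l) = gcdn (n %/ d) (n %/ l))%N.
  rewrite nd nl -muln_gcdr gcdnC (eqP cdl) muln1 nE mulnK // muln_gt0 d0 //.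
rewrite -(cardID [pred t | y t ^+ (n %/ l) == 1]) addnC; congr addn.
  by apply: eq_card => t; rewrite !inE /= andbCA.
apply: eq_card => t; rewrite !inE /= ndl expr_gcdn_eq1 1?andbAC //.
by rewrite nd muln_gt0 k0.
Qed.

(** The main term satisfies the same recursion as [sifted_cons], so each prime at
    most doubles the error. *)
Lemma sieve_bound (X E : R) :
  (forall d, (d %| n)%N -> `|(sifted d [::])%:R - X / d%:R| <= E) ->
  forall s d, uniq s -> all prime s -> all (coprime d) s ->
    (d * \prod_(l <- s) l %| n)%N ->
  `|(sifted d s)%:R - X / d%:R * \prod_(l <- s) (1 - l%:R^-1)|
     <= 2 ^+ size s * E.
Proof.
move=> HE; elim=> [|l s IHs] d /=.
  by move=> _ _ _; rewrite !big_nil muln1 mulr1 mul1r; exact: HE.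
case/andP=> ls us /andP[pl ps] /andP[cdl cds]; rewrite !big_cons mulnA => dvn.
have dln : (d * l %| n)%N by apply: dvdn_trans dvn; exact: dvdn_mulr.
have H1 : (d * \prod_(l <- s) l %| n)%N.
  apply: dvdn_trans dvn; rewrite mulnAC; exact: dvdn_mulr.
have H2 := IHs (d * l)%N us ps _ dvn.
have {}H1 := IHs _ us ps cds H1.
have {}H2 : `|(sifted (d * l) s)%:R -
    X / (d * l)%:R * \prod_(l0 <- s) (1 - l0%:R^-1)| <= 2 ^+ size s * E.
  apply: H2; apply/allP => q qs; rewrite coprimeMl (allP cds) //=.
  rewrite prime_coprime // (dvdn_prime2 pl (allP ps q qs)).
  by apply: contraNneq ls => ->.
have -> : (sifted d (l :: s))%:R - X / d%:R * ((1 - l%:R^-1) * \prod_(j <- s) (1 - j%:R^-1))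
   = ((sifted d s)%:R - X / d%:R * \prod_(l0 <- s) (1 - l0%:R^-1))
     - ((sifted (d * l) s)%:R - X / (d * l)%:R * \prod_(l0 <- s) (1 - l0%:R^-1)) :> R.
  rewrite (sifted_cons s cdl dln) natrD natrM invfM; move: (\prod_(_ <- _) _) => P; ring.
apply: le_trans (ler_normB _ _) _; apply: le_trans (lerD H1 H2) _.
by rewrite exprS -mulrA [2%:R * _]mulr_natl mulr2n.
Qed.

End Sieve.

Lemma prime_primes n : all prime (primes n).
Proof. by apply/allP => q; rewrite mem_primes => /and3P[]. Qed.

Lemma prod_primes_dvdn n : (0 < n)%N -> (\prod_(l <- primes n) l %| n)%N.
Proof.
move=> n0; rewrite [X in (_ %| X)%N](prod_prime_decomp n0) prime_decompE big_map /=.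
rewrite big_seq [X in (_ %| X)%N]big_seq.
elim/big_ind2: _ => // [a b c d|q qn]; first exact: dvdn_mul.
by rewrite dvdn_exp // logn_gt0.
Qed.

Lemma totient_primes (R : realFieldType) n : (0 < n)%N ->
  (totient n)%:R / n%:R = \prod_(l <- primes n) (1 - l%:R^-1) :> R.
Proof.
move=> n0; have nE : n = (\prod_(q <- primes n) q ^ logn q n)%N.
  by rewrite {1}(prod_prime_decomp n0) prime_decompE big_map.
rewrite totientE // [X in _ / X%:R]nE !natr_prod -prodf_div big_seq [RHS]big_seq; apply: eq_bigr => q.
rewrite mem_primes => /and3P[pq _ qn].
have : (0 < logn q n)%N by rewrite logn_gt0 mem_primes pq n0.
have q1 := prime_gt1 pq.
case: (logn q n) => //= k _; rewrite expnS !natrM -subn1 natrB ?(ltnW q1) //.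
have q0 : q%:R != 0 :> R by rewrite pnatr_eq0; lia.
have qk0 : (q ^ k)%:R != 0 :> R by rewrite pnatr_eq0 expn_eq0; lia.
by field; rewrite q0.
Qed.

(** A proper divisor of [p.-1] divides [p.-1 %/ l] for some prime [l]. *)
Lemma primitive_root_modE (p : nat) (z : 'F_p) : prime p ->
  primitive_root_mod z =
  (z ^+ p.-1 == 1) && all (fun l => z ^+ (p.-1 %/ l) != 1) (primes p.-1).
Proof.
move=> pp; have n0 : (0 < p.-1)%N by have := prime_gt1 pp; lia.
have cardU : #|[set: {unit 'F_p}]%SET| = p.-1 by rewrite card_finField_unit card_Fp.
have genE (u : {unit 'F_p}) : generator [set: {unit 'F_p}]%SET u = (#[u]%g == p.-1).
  rewrite /generator eq_sym eqEcard finset.subsetT /= cardU -orderE.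
  by rewrite eqn_leq -{2}cardU subset_leq_card ?finset.subsetT.
have powE (u : {unit 'F_p}) k : (val u ^+ k == 1) = (#[u]%g %| k)%N.
  rewrite order_dvdn -(FinRing.val_unitX k u) -(FinRing.val_unit1 _).
  exact: (inj_eq val_inj).
apply/existsP/andP => [[u /andP[/eqP <-]]|[zn /allP H]].
  rewrite genE => /eqP uE; rewrite powE uE dvdnn; split=> //.
  apply/allP => l; rewrite mem_primes => /and3P[pl _ ln]; rewrite powE uE.
  have := ltn_Pdiv (prime_gt1 pl) n0.
  have : (0 < p.-1 %/ l)%N by rewrite divn_gt0 ?prime_gt0 // dvdn_leq.
  by move=> h1 h2; apply/negP => /(dvdn_leq h1); rewrite leqNgt h2.
have zU : z \is a GRing.unit.
  by rewrite unitfE; apply: contraTneq zn => ->; rewrite expr0n eqn0Ngt n0 eq_sym oner_neq0.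
pose u := FinRing.unit 'F_p zU; exists u; rewrite eqxx genE /=.
have un : (#[u]%g %| p.-1)%N by rewrite -powE.
apply/negPn/negP => une; have u0 := order_gt0 u.
have q1 : (1 < p.-1 %/ #[u]%g)%N.
  rewrite ltn_divRL // mul1n ltn_neqAle une dvdn_leq //.
have pl := pdiv_prime q1; set l := pdiv _ in pl.
have luq : (l * #[u]%g %| p.-1)%N by rewrite -(divnK un) dvdn_mul ?pdiv_dvd.
have ln : (l %| p.-1)%N by apply: dvdn_trans luq; exact: dvdn_mulr.
have := H l; rewrite mem_primes pl n0 ln => /(_ isT) /negP; apply.
by rewrite (powE u) dvdn_divRL // mulnC.
Qed.

(** * Asymptotics *)

Lemma num_primitive_values_sifted (f : {poly int}) (p : nat) : prime p ->
  num_primitive_values f p =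
  sifted (fun x : 'F_p => (map_poly intr f).[x]) p.-1 1 (primes p.-1).
Proof.
move=> pp; rewrite /num_primitive_values cardsE; apply: eq_card => x.
by rewrite divn1; exact: primitive_root_modE.
Qed.

Lemma prod_primes_ge (R : realFieldType) (n : nat) :
  2^-1 ^+ size (primes n) <= \prod_(l <- primes n) (1 - l%:R^-1) :> R.
Proof.
have := prime_primes n; elim: (primes n) => [|l s IHs] /=; first by rewrite big_nil.
case/andP=> pl /IHs H; rewrite big_cons exprS ler_pM ?invr_ge0 ?exprn_ge0 ?invr_ge0 //.
have l2 : l%:R^-1 <= 2^-1 :> R.
  by rewrite lef_pV2 ?posrE ?ltr0n ?prime_gt0 // ler_nat prime_gt1.
by lra.
Qed.

(** Primes [l >= 2 ^ K] contribute a factor [2 ^ K <= l] each, and there are fewer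
    than [2 ^ K] smaller ones. *)
Lemma omega_bound (K : nat) : exists2 C, (0 < C)%N &
  forall n, (0 < n)%N -> (2 ^ (K * size (primes n)) <= C * n)%N.
Proof.
pose M := (2 ^ K)%N; have M0 : (0 < M)%N by rewrite expn_gt0.
exists (M ^ M)%N; first by rewrite expn_gt0 M0.
move=> n n0; rewrite expnM -/M.
have step s : all prime s -> (M ^ size s <= M ^ count (fun l => (l < M)%N) s * \prod_(l <- s) l)%N.
  elim: s => [|l s IHs] /=; first by rewrite big_nil.
  case/andP=> /prime_gt0 l0 /IHs H; rewrite big_cons expnS expnD -mulnA.
  rewrite [(M ^ _ * (l * _))%N]mulnCA mulnA; apply: leq_mul => //.
  case: ltnP => lM; first by rewrite expn1 leq_pmulr.
  by rewrite expn0 mul1n.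
apply: leq_trans (step _ (prime_primes n)) _; apply: leq_mul.
  rewrite leq_pexp2l // -size_filter -[leqRHS](size_iota 0).
  apply: uniq_leq_size; first by rewrite filter_uniq // primes_uniq.
  by move=> l; rewrite mem_filter mem_iota /= => /andP[].
by rewrite dvdn_leq // prod_primes_dvdn.
Qed.

Lemma exists_integer_root (k n : nat) : (0 < k)%N ->
  exists r, (r ^ k <= n < r.+1 ^ k)%N.
Proof.
move=> k0; elim: n => [|n [r /andP[rn nr]]].
  by exists 0%N; rewrite exp0n // exp1n.
have [lt|le] := ltnP n.+1 (r.+1 ^ k).
  by exists r; rewrite lt andbT ltnW.
exists r.+1; rewrite le /=; apply: leq_ltn_trans nr _.
by rewrite ltn_exp2r.
Qed.

(** All the counting is put together here: [B] remains free, subject only to being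
    small compared with [p]. *)
Lemma num_primitive_values_estimate (R : realFieldType) (f : {poly int}) :
  ~ const_times_power f -> exists N, forall p B, prime p -> (N < p)%N -> (0 < B)%N ->
  let m := size f in
  (B * (B * (B * B * m + B + 1) + 1) + B * m < p)%N ->
  `|(num_primitive_values f p)%:R - p%:R * ((totient p.-1)%:R / p.-1%:R)|
    <= 2 ^+ size (primes p.-1) * ((2 * m + 2)%:R * p%:R / B%:R) :> R.
Proof.
move=> nf; have [N HN] := good_reduction nf; exists N => p B pp Np B0 m small.
have [sE fH] := HN p pp Np; have n0 : (0 < p.-1)%N by have := prime_gt1 pp; lia.
have f1 : (1 < size f)%N.
  rewrite ltnNge; apply/negP => /size1_polyC fE; apply: nf.
  by exists f`_0, 1, 2%N; rewrite expr1n alg_polyC.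
rewrite num_primitive_values_sifted // totient_primes //.
rewrite -[p%:R * \prod_(_ <- _) _]/((p%:R * \prod_(l <- primes p.-1) (1 - l%:R^-1))).
have -> : p%:R = p%:R / 1%:R :> R by rewrite divr1.
apply: sieve_bound => //.
- move=> d dn; rewrite divr1.
  have := @power_values_count 'F_p p (pchar_Fp pp) (card_Fp pp) (map_poly intr f) m _ _ fH R d B dn B0 small.
  rewrite sE => /(_ f1 (leqnSn _)).
  congr (`|_%:R - _| <= _); apply: eq_card => x; rewrite !inE andbT //.
- exact: primes_uniq.
- exact: prime_primes.
- by apply/allP => l _; exact: coprime1n.
- by rewrite mul1n prod_primes_dvdn.
Qed.

(** The choice [B = r ^ 2] with [r] about [p ^ (1/10)] satisfies the smallness
    condition, which asks for [B ^ 4] times a constant to be less than [p]. The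
    relative error is then [4 ^ w * O(r ^ -2)], and [omega_bound] with [K = 20]
    gives [4 ^ w = O(r)]. *)
Lemma relative_error_bound (R : realFieldType) (f : {poly int}) :
  ~ const_times_power f -> exists (A : R) (r0 : nat),
  forall r p, prime p -> (r0 < r)%N -> (r ^ 10 <= p < r.+1 ^ 10)%N ->
  `|(num_primitive_values f p)%:R / (p%:R * (totient p.-1)%:R / p.-1%:R) - 1|
    <= A / r%:R :> R.
Proof.
move=> nf; have [N HN] := num_primitive_values_estimate R nf.
have [C C0 HC] := omega_bound 20; set m := size f in HN.
exists (2 * C * (2 * m + 2))%N%:R, (N + (2 * m + 3))%N => r p pp r0 /andP[rp pr].
have r1 : (0 < r)%N by lia.
have p1 := prime_gt1 pp; have n0 : (0 < p.-1)%N by lia.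
pose B := (r ^ 2)%N; have B0 : (0 < B)%N by rewrite expn_gt0 r1.
have small : (B * (B * (B * B * m + B + 1) + 1) + B * m < p)%N.
  apply: leq_trans rp; have -> : (r ^ 10 = B ^ 5)%N by rewrite -expnM.
  have Bm : (2 * m + 3 < B)%N.
    apply: leq_trans (_ : r <= _)%N; first by lia.
    by rewrite /B expnS leq_pmulr ?expn_gt0 ?r1.
  apply: leq_trans (_ : B ^ 4 * B <= _)%N; last by rewrite [(B ^ 5)%N]expnSr.
  apply: leq_ltn_trans (_ : B ^ 4 * (2 * m + 3) < _)%N; last first.
    have B40 : (0 < B ^ 4)%N by rewrite expn_gt0 B0.
    by rewrite (ltn_pmul2l B40).
  have := leq_pexp2l B0 (isT : 1 <= 4)%N; have := leq_pexp2l B0 (isT : 2 <= 4)%N.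
  have := leq_pexp2l B0 (isT : 3 <= 4)%N.
  rewrite expn1 => h3 h2 h1.
  have -> : (B * (B * (B * B * m + B + 1) + 1) + B * m =
     B ^ 4 * m + B ^ 3 + B ^ 2 + B + B * m)%N by rewrite !expnS expn0; ring.
  have := leq_mul h1 (leqnn m); lia.
have Np : (N < p)%N.
  apply: leq_trans rp; apply: leq_trans (_ : r <= _)%N; first by lia.
  by rewrite expnS leq_pmulr ?expn_gt0 ?r1.
have := HN p B pp Np B0 small.
set w := size (primes p.-1); set g := (num_primitive_values f p)%:R.
set t := (totient p.-1)%:R / p.-1%:R => est.
have tw : 2^-1 ^+ w <= t :> R by rewrite /t totient_primes // prod_primes_ge.
have w0 : 0 < 2 ^+ w :> R by rewrite exprn_gt0.
have p0 : 0 < p%:R :> R by rewrite ltr0n ltnW.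
have tgt : 0 < t by apply: lt_le_trans tw; rewrite exprn_gt0 // invr_gt0.
have pt0 : 0 < p%:R * t by rewrite mulr_gt0.
rewrite -[p%:R * _ / _]mulrA -/t.
have -> : g / (p%:R * t) - 1 = (g - p%:R * t) / (p%:R * t).
  by field; rewrite !gt_eqF.
rewrite normrM normfV (gtr0_norm pt0) ler_pdivrMr //; apply: le_trans est _.
have wr : (4 ^ w <= 2 * C * r)%N.
  apply: leq_trans (_ : C * r.+1 <= _)%N; last first.
    by rewrite (mulnC 2) -mulnA leq_mul2l mul2n -addnn -addn1 leq_add2l r1 orbT.
  rewrite -(@leq_exp2r _ _ 10) // -expnM.
  have -> : (4 ^ (w * 10) = 2 ^ (20 * w))%N.
    by rewrite (_ : 4 = 2 ^ 2)%N // -expnM; congr expn; lia.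
  apply: leq_trans (HC _ n0) _; rewrite expnMn; apply: leq_mul.
    by rewrite -{1}(expn1 C) leq_pexp2l.
  by apply: leq_trans (leq_pred _) (ltnW pr).
have wrR : 2 ^+ w * 2 ^+ w <= (2 * C * r)%N%:R :> R.
  by rewrite -exprMn -natrM -natrX ler_nat.
have r0R : 0 < r%:R :> R by rewrite ltr0n.
have tw1 : 1 <= 2 ^+ w * t.
  by rewrite -(ler_pM2l w0) in tw; apply: le_trans tw; rewrite -exprMn divff ?expr1n.
set c := (2 * m + 2)%:R.
have c0 : 0 <= c :> R by [].
rewrite natrM -/c /B natrX.
apply: le_trans (_ : 2 ^+ w * (c * p%:R / r%:R ^+ 2) * (2 ^+ w * t) <= _).
  by rewrite ler_peMr // !mulr_ge0 // ?invr_ge0 ?exprn_ge0 // ltW.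
have -> : 2 ^+ w * (c * p%:R / r%:R ^+ 2) * (2 ^+ w * t) =
   (2 ^+ w * 2 ^+ w) * (c * p%:R * t / r%:R ^+ 2) by ring.
apply: le_trans (_ : (2 * C * r)%N%:R * (c * p%:R * t / r%:R ^+ 2) <= _).
  by rewrite ler_wpM2r // !mulr_ge0 // ?invr_ge0 ?exprn_ge0 // ltW.
by rewrite natrM le_eqVlt; apply/orP; left; apply/eqP; field; rewrite gt_eqF.
Qed.

Theorem theorem5p2 (R : realType) (f : {poly int})
    (hf : ~ const_times_power f) :
  exists e : nat -> R,
    e p @[p --> prime_oo] --> (0 : R) /\
    forall p : nat, prime p ->
      (num_primitive_values f p)%:R =
        p%:R * (totient p.-1)%:R / (p.-1)%:R * (1 + e p).
Proof.
have [A [r0 HA]] := relative_error_bound R hf.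
exists (fun p => (num_primitive_values f p)%:R /
  (p%:R * (totient p.-1)%:R / p.-1%:R) - 1); split; last first.
  move=> p pp; have p1 := prime_gt1 pp.
  rewrite addrC subrK mulrC divfK // !mulf_neq0 ?invr_eq0 // pnatr_eq0 -lt0n.
  - by rewrite ltnW.
  - by rewrite totient_gt0; lia.
  - by lia.
rewrite /prime_oo; apply/cvgrPdist_lt => eps eps0.
pose r1 := (maxn r0.+1 (Num.truncn (A / eps)).+1).
exists (r1 ^ 10)%N => //= p /= r1p pp; rewrite sub0r normrN.
have [r rP] := exists_integer_root p (isT : 0 < 10)%N.
have r1r : (r1 <= r)%N.
  have /andP[_ pr] := rP.
  by have := leq_ltn_trans r1p pr; rewrite ltn_exp2r.
have rr0 : (r0 < r)%N by apply: leq_trans r1r; rewrite leq_maxl.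
have r0R : 0 < r%:R :> R by rewrite ltr0n (leq_ltn_trans _ rr0).
apply: le_lt_trans (HA r p pp rr0 rP) _.
rewrite ltr_pdivrMr // -ltr_pdivrMl // mulrC.
apply: lt_le_trans (truncnS_gt _) _; rewrite ler_nat.
by apply: leq_trans r1r; rewrite leq_maxr.
Qed.
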